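(* Let $k\ge 4$ be an integer. Then for every sufficiently large integer $d$ there exists a tree $T$ with diameter $d$ and order $n=2d+1$ such that $\mu_{tsp,k}(C_n)<\mu_{tsp,k}(T)$.
   Context: $C_n$ is the cycle on $n$ vertices. For a set $S$ of $k$ vertices of a connected graph $G$ of order $n$, $\mathrm{tsp}_k(S)$ is the length (number of edge traversals, with multiplicity) of a shortest closed walk in $G$ visiting all vertices of $S$, and $\mu_{tsp,k}(G)=\binom{n}{k}^{-1}\sum_{S\subseteq V,\,|S|=k}\mathrm{tsp}_k(S)$. *)

(* Defs.v *)
From Stdlib Require Import ClassicalEpsilon.
From mathcomp Require Import all_boot all_order all_algebra.
Set Implicit Arguments. Unset Strict Implicit. Unset Printing Implicit Defensive.

Definition least_nat (P : pred nat) : nat :=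
  match excluded_middle_informative (exists n, P n) with
  | left H => ex_minn H
  | right _ => 0
  end.

Section Graphs.
Variable T : finType.
Variable e : rel T.

Definition simple_graph : Prop := symmetric e /\ irreflexive e.
Definition connected_graph : Prop := forall x y : T, connect e x y.
Definition acyclic_graph : Prop :=
  forall c : seq T, uniq c -> 2 < size c -> ~~ cycle e c.
Definition is_tree : Prop := simple_graph /\ connected_graph /\ acyclic_graph.

Definition has_walk (x y : T) (l : nat) : bool :=
  [exists t : l.-tuple T, path e x t && (last x t == y)].
Definition dist (x y : T) : nat := least_nat (has_walk x y).
Definition diameter : nat := \max_(x : T) \max_(y : T) dist x y.

Definition has_tour (S : {set T}) (l : nat) : bool :=
  [exists x : T, exists t : l.-tuple T,
     [&& path e x t, last x t == x & S \subset [pred z | z \in x :: val t]]].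
Definition tsp (S : {set T}) : nat := least_nat (has_tour S).

Definition mu_tsp (k : nat) : rat :=
  ((\sum_(S : {set T} | #|S| == k) tsp S)%:R / ('C(#|T|, k))%:R)%R.
End Graphs.

Definition cycle_rel (n : nat) : rel 'I_n :=
  fun i j => (j == (i.+1 %% n) :> nat) || (i == (j.+1 %% n) :> nat).
Arguments cycle_rel n : clear implicits.

(* Main.v *)
(** Write [n = 2d + 1].  On the cycle, a set that fits in an arc of [m <= d] edges has a tour
    of length [2m], and every set has one of length [n]; summing over arcs gives
    [mu(C_n) <= n + 1 - 2n C(d+1,k)/C(n,k) ~ n (1 - 2^(1-k))].
    For the tree, take three legs of about [d/2] edges and hang the remaining [d/2] vertices
    near the ends of the legs, distributed evenly.  A closed walk through [S] crosses twice
    every edge separating [S], and along each leg the proportion of vertices beyond an edge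
    runs from [1/3] down to [1/12], so that
    [mu(T)/n >~ 6 \int_(1/12)^(1/3) (1 - p^k - (1-p)^k) dp].
    For [k = 4, 5] this exceeds [1 - 2^(1-k)] (by [0.0014] when [k = 4]); for [k = 6] it exceeds
    [1], hence also for [k > 6], the integrand being increasing in [k].  Both sums are exact
    hockey-stick sums of binomial coefficients, which turns the comparison for [k <= 6] into
    polynomial inequalities in [d]. *)
Require Import Defs.
From mathcomp Require Import all_boot all_order all_algebra.
From mathcomp Require Import zify.
From Stdlib Require Import ClassicalEpsilon Lia.
From Stdlib Require ZArith.
Set Implicit Arguments. Unset Strict Implicit. Unset Printing Implicit Defensive.
Import Order.TTheory GRing.Theory Num.Theory.

(** * Closed walks and cuts *)

Lemma least_natP (P : pred nat) : (exists n, P n) -> P (least_nat P).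
Proof.
by rewrite /least_nat; case: excluded_middle_informative => // exP _; case: ex_minnP.
Qed.

Lemma least_nat_le (P : pred nat) n : P n -> least_nat P <= n.
Proof.
rewrite /least_nat; case: excluded_middle_informative => // exP Pn.
by case: ex_minnP => m _; apply.
Qed.

Section Walks.
Variables (T : finType) (e : rel T).

Lemma has_walkP x y l :
  reflect (exists t, [/\ path e x t, last x t = y & size t = l]) (has_walk e x y l).
Proof.
apply: (iffP existsP) => [[t /andP[pt /eqP lt]] | [t [pt lt st]]].
  by exists t; rewrite size_tuple.
move/eqP: st => st; exists (Tuple st).
by rewrite /= pt lt eqxx.
Qed.

Lemma has_tourP (S : {set T}) l :
  reflect (exists x t, [/\ path e x t, last x t = x,
                           {subset S <= x :: t} & size t = l])
          (has_tour e S l).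
Proof.
apply: (iffP existsP) => [[x /existsP[t /and3P[pt /eqP lt /subsetP St]]] | [x [t [pt lt St st]]]].
  by exists x, t; rewrite size_tuple; split=> // z /St.
move/eqP: st => st; exists x; apply/existsP; exists (Tuple st).
by rewrite /= pt lt eqxx; apply/subsetP => z /St.
Qed.

Lemma tsp_le (S : {set T}) x t :
  path e x t -> last x t = x -> {subset S <= x :: t} -> tsp e S <= size t.
Proof. by move=> pt lt St; apply/least_nat_le/has_tourP; exists x, t. Qed.

Lemma rev_walk x t : symmetric e -> path e x t ->
  path e (last x t) (rev (belast x t)).
Proof. by move=> e_sym; rewrite rev_path (eq_path (e' := e)). Qed.

Lemma last_rev_belast (x : T) t : last (last x t) (rev (belast x t)) = x.
Proof. by case: t => // y t; rewrite /= rev_cons last_rcons. Qed.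

(** Walk along [t] and return the same way. *)
Lemma tsp_le_walk (S : {set T}) x t : symmetric e ->
  path e x t -> {subset S <= x :: t} -> tsp e S <= (size t).*2.
Proof.
move=> e_sym pt St.
apply: leq_trans (tsp_le (x := x) (t := t ++ rev (belast x t)) _ _ _) _.
- by rewrite cat_path pt rev_walk.
- by rewrite last_cat last_rev_belast.
- by move=> z /St; rewrite !inE mem_cat orbA => ->.
- by rewrite size_cat size_rev size_belast addnn.
Qed.

(** [least_nat] returns 0 on an empty predicate, so lower bounds on [tsp] rest on the existence of a
    tour. *)
Lemma tour_exists (x : T) (S : {set T}) : connected_graph e ->
  exists l, has_tour e S l.
Proof.
move=> e_conn.
have [t [pt St]] : exists t, path e x t /\ {subset enum S <= x :: t}.
  elim: (enum S) => [|y s [t [pt st]]]; first by exists [::].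
  have /connectP[u pu lu] := e_conn (last x t) y.
  exists (t ++ u); rewrite cat_path pt; split=> // z.
  rewrite inE => /predU1P[-> | /st]; last by rewrite !inE mem_cat orbA => ->.
  by rewrite lu -last_cat mem_last.
have /connectP[u pu lu] := e_conn (last x t) x.
exists (size (t ++ u)); apply/has_tourP; exists x, (t ++ u).
rewrite cat_path pt last_cat; split=> // z zS.
by rewrite inE mem_cat orbA -in_cons St // mem_enum.
Qed.

Fixpoint crossings (b : pred T) (x : T) (t : seq T) : nat :=
  if t is y :: t' then (b x != b y) + crossings b y t' else 0.

Lemma crossings_cat b x t u :
  crossings b x (t ++ u) = crossings b x t + crossings b (last x t) u.
Proof. by elim: t x => //= y t IHt x; rewrite IHt addnA. Qed.

Lemma crossings_gt0 (b : pred T) x t : b x != b (last x t) -> 0 < crossings b x t.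
Proof.
elim: t x => [|y t IHt] x /=; first by rewrite eqxx.
by case: (eqVneq (b x) (b y)) => // -> /IHt.
Qed.

(** Split at a visit to [y]: the closed walk changes side at least once before it and once after
    it. *)
Lemma crossings_ge2 (b : pred T) x y t :
  last x t = x -> y \in x :: t -> b y != b x -> 1 < crossings b x t.
Proof.
move=> lt; rewrite inE => /predU1P[-> | yt nb_yx]; first by rewrite eqxx.
case/splitPr: yt lt => t1 t2; rewrite last_cat /= => lt.
rewrite -cat_rcons crossings_cat last_rcons -addn1 leq_add //.
  by apply: crossings_gt0; rewrite last_rcons eq_sym.
by apply: crossings_gt0; rewrite lt.
Qed.

Definition separates (b : pred T) (S : {set T}) : bool :=
  [exists y in S, b y] && [exists z in S, ~~ b z].

Section Cuts.
Variables (I : finType) (b : I -> pred T).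
Hypothesis edge_cut : forall x y, e x y -> \sum_i (b i x != b i y) <= 1.

Lemma sum_crossings x t : path e x t -> \sum_i crossings (b i) x t <= size t.
Proof.
elim: t x => [|y t IHt] x /=; first by rewrite big1.
by case/andP=> /edge_cut exy /IHt pt; rewrite big_split /= -add1n leq_add.
Qed.

(** A tour crosses each cut separating [S] at least twice. By [edge_cut] one step crosses at most
    one cut of the family, so all these crossings together are at most the length. *)
Lemma sum_separates_tsp (x0 : T) (S : {set T}) : connected_graph e ->
  2 * \sum_i separates (b i) S <= tsp e S.
Proof.
move=> e_conn; have /least_natP/has_tourP := tour_exists x0 S e_conn.
rewrite -/(tsp e S) => -[x [t [pt lt St <-]]].
apply: leq_trans (sum_crossings pt); rewrite big_distrr /=.
apply: leq_sum => i _;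
case: (boolP (separates _ _)) => //= /andP[/exists_inP[y yS yb] /exists_inP[z zS zb]].
case: (boolP (b i x)) => xb.
  by apply: (crossings_ge2 (y := z)); rewrite ?St // (negbTE zb) xb.
by apply: (crossings_ge2 (y := y)); rewrite ?St // (negbTE xb) yb.
Qed.

End Cuts.

(** A [k]-set that is not separated lies in [b] or in its complement, and not in both because
    [0 < k]. *)
Lemma sum_separates (b : pred T) k : 0 < k ->
  \sum_(S : {set T} | #|S| == k) separates b S
    + ('C(#|b|, k) + 'C(#|T| - #|b|, k)) = 'C(#|T|, k).
Proof.
move=> k_gt0.
rewrite -(cardsE b); set B := [set x | b x].
have -> : #|T| - #|B| = #|~: B| by rewrite [RHS]cardsCs setCK.
rewrite -!cards_draws -card_draws.
rewrite -[RHS](cardsID [set S | separates b S]); congr (_ + _).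
  rewrite -big_mkcondr /= sum1_card -cardsE.
  by apply: eq_card => S; rewrite !inE.
set inB := [set S : {set T} | S \subset B & _].
set inC := [set S : {set T} | S \subset ~: B & _].
have disj : inB :&: inC = set0.
  apply/setP => S; rewrite !inE; apply/negP => /andP[/andP[sub /eqP cS] /andP[subC _]].
  have : 0 < #|S| by rewrite cS.
  by case/card_gt0P => x xS; have := subsetP subC _ xS; rewrite inE (subsetP sub _ xS).
rewrite -cardsUI disj cards0 addn0.
apply: eq_card => S; rewrite !inE -andb_orl; congr (_ && _).
rewrite negb_and orbC; congr (_ || _).
  by apply/subsetP/exists_inPn => sub x xS; have := sub x xS; rewrite !inE.
apply/subsetP/exists_inPn => sub x xS; first by have := sub x xS; rewrite inE negbK.
by have := sub x xS; rewrite inE negbK.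
Qed.

End Walks.

(** * The cycle *)

Section Cycle.
Variable n : nat.
Implicit Types (i j : 'I_n) (S : {set 'I_n}).

Lemma cycle_rel_sym : symmetric (cycle_rel n).
Proof. by move=> i j; rewrite /cycle_rel orbC. Qed.

Lemma cycle_rel_ordS i : cycle_rel n i (ordS i).
Proof. by rewrite /cycle_rel eqxx. Qed.

Lemma val_iter_ordS m i : val (iter m (@ordS n) i) = (i + m) %% n.
Proof.
elim: m => [|m IHm] /=; first by rewrite addn0 modn_small.
by rewrite IHm -(addn1 (_ %% _)) modnDml addn1 addnS.
Qed.

Definition offset i j : nat := (j + (n - i)) %% n.

Lemma iter_offset i j : iter (offset i j) (@ordS n) i = j.
Proof.
apply: val_inj; rewrite val_iter_ordS /offset modnDmr addnCA subnKC ?modnDr ?modn_small //.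
exact: ltnW.
Qed.

Lemma offset_iter i m : m < n -> offset i (iter m (@ordS n) i) = m.
Proof.
move=> lt_mn; rewrite /offset val_iter_ordS modnDml addnAC subnKC ?modnDl ?modn_small //.
exact: ltnW.
Qed.

Lemma offsetE i j : offset i j = if i <= j then j - i else j + n - i.
Proof.
have [lt_i lt_j] := (ltn_ord i, ltn_ord j); rewrite /offset; case: leqP => le_ij.
  have -> : j + (n - i) = n + (j - i) by lia.
  by rewrite modnDl modn_small //; lia.
by rewrite modn_small; lia.
Qed.

Definition arc i m : {set 'I_n} := [set j | offset i j <= m].

Lemma card_arc i m : m < n -> #|arc i m| = m.+1.
Proof.
move=> lt_mn.
have -> : arc i m = [set iter (val t) (@ordS n) i | t : 'I_m.+1].
  apply/setP => j; rewrite inE; apply/idP/imsetP => [le_jm | [t _ ->]].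
    by exists (Ordinal (le_jm : offset i j < m.+1)); rewrite ?iter_offset.
  by have := ltn_ord t => lt_tm; rewrite offset_iter /=; lia.
rewrite card_imset ?card_ord // => s t eq_st; apply: val_inj.
have [lt_s lt_t] := (ltn_ord s, ltn_ord t).
by rewrite /= -(@offset_iter i s) ?eq_st ?offset_iter //=; lia.
Qed.

Lemma arc_start i m : i \in arc i m.
Proof. by rewrite inE /offset subnKC ?modnn // ltnW. Qed.

Let ordS_path i m := traject (@ordS n) (ordS i) m.

Lemma ordS_pathP i m : path (cycle_rel n) i (ordS_path i m).
Proof.
apply: sub_path (fpath_traject (@ordS n) i m) => x _ /eqP <-.
exact: cycle_rel_ordS.
Qed.

Lemma arc_sub_ordS_path i m : {subset arc i m <= i :: ordS_path i m}.
Proof.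
move=> j; rewrite inE => le_jm; rewrite -/(traject _ i m.+1).
by apply/trajectP; exists (offset i j); rewrite ?iter_offset.
Qed.

Lemma cycle_tsp_arc i m S : S \subset arc i m -> tsp (cycle_rel n) S <= m.*2.
Proof.
move=> /subsetP S_arc; rewrite -[m in m.*2](size_traject (@ordS n) (ordS i)).
apply: tsp_le_walk cycle_rel_sym (ordS_pathP i m) _ => j /S_arc.
exact: arc_sub_ordS_path.
Qed.

Lemma cycle_tsp_le i S : tsp (cycle_rel n) S <= n.
Proof.
rewrite -[X in _ <= X](size_traject (@ordS n) (ordS i)).
apply: tsp_le (ordS_pathP i n) _ _ => [|j _].
  by rewrite last_traject; apply: val_inj; rewrite val_iter_ordS modnDr modn_small.
apply: arc_sub_ordS_path; rewrite inE ltnW // ltn_pmod //.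
exact: leq_ltn_trans (ltn_ord i).
Qed.

End Cycle.

Lemma sum_geq p a : \sum_(m < p) (a <= m) = p - a.
Proof. by elim: p => [|p IHp]; rewrite ?big_ord0 // big_ord_recr IHp /=; lia. Qed.

Lemma sum_draws_through (T : finType) (A : {set T}) (x : T) (k : nat) : x \in A ->
  \sum_(S : {set T} | #|S| == k) ((x \in S) && (S \subset A)) + 'C(#|A|.-1, k)
  = 'C(#|A|, k).
Proof.
move=> xA; rewrite -cards_draws -[RHS](cardsID [set S : {set T} | x \in S]).
congr (_ + _).
  rewrite -sum1_card big_mkcond [RHS]big_mkcond; apply: eq_bigr => S _.
  by rewrite !inE; move: (x \in S) (S \subset A) (_ == k) => [] [] [].
rewrite (cardsD1 x A) xA add1n succnK -cards_draws.
by apply: eq_card => S; rewrite !inE subsetD1; move: (x \in S) (S \subset A) (_ == k) => [] [] [].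
Qed.

(** * Upper bound for the odd cycle *)

Section OddCycle.
Variable d : nat.
Let n := 2 * d + 1.
Implicit Types (i j : 'I_n) (S : {set 'I_n}).

(** The condition [i \in S] anchors the arc, so that for [m <= d] its start is determined by [S]. *)
Definition short_arc S i (m : nat) : bool := (i \in S) && (S \subset arc i m).

(** For distinct [i] and [j] the two offsets between them add up to [n = 2d + 1], which exceeds
    [a + b]. *)
Lemma short_arc_uniq S i j a b : a <= d -> b <= d ->
  short_arc S i a -> short_arc S j b -> i = j.
Proof.
move=> le_ad le_bd /andP[iS /subsetP Sa] /andP[jS /subsetP Sb].
have := Sa j jS; have := Sb i iS; rewrite !inE !offsetE => ij ji.
apply: val_inj; have := ltn_ord i; have := ltn_ord j.
by move: ij ji; rewrite /n /=; do 2 case: ifP; lia.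
Qed.

(** If [m0] is the least length of a short arc containing [S], at most [d + 1 - m0] pairs are
    counted, and [2 m0 + 2 (d + 1 - m0) = n + 1]. Without a short arc, the tour round the whole
    cycle has length [n]. *)
Lemma cycle_tsp_short_arc S : 0 < #|S| ->
  tsp (cycle_rel n) S + 2 * (\sum_i \sum_(m < d.+1) short_arc S i m) <= n.+1.
Proof.
move=> /card_gt0P[x _].
pose has_arc (m : 'I_d.+1) := [exists i, short_arc S i m].
case: (boolP [exists m, has_arc m]); last first.
  move=> no_arc; rewrite big1 => [|i _]; last first.
    apply: big1 => m _; apply/eqP; rewrite eqb0; apply: contra no_arc => arc_im.
    by apply/existsP; exists m; apply/existsP; exists i.
  by rewrite addn0 ltnW // ltnS cycle_tsp_le.
case/existsP=> m1 has1.
case: (@arg_minnP _ m1 has_arc (fun m : 'I_d.+1 => m : nat) has1) => m0 /existsP[i arc_im0] m0_min.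
have others : \sum_(j | j != i) \sum_(m < d.+1) short_arc S j m = 0.
  apply: big1 => j ne_ji; apply: big1 => m _; apply/eqP; rewrite eqb0.
  apply: contra ne_ji => arc_jm; apply/eqP.
  exact: (short_arc_uniq (ltn_ord m : m <= d) (ltn_ord m0 : m0 <= d) arc_jm arc_im0).
rewrite (bigD1 i) //= others addn0.
have count : \sum_(m < d.+1) short_arc S i m <= d.+1 - m0.
  rewrite -sum_geq; apply: leq_sum => m _; case: (boolP (short_arc _ _ _)) => // arc_im.
  by rewrite m0_min //; apply/existsP; exists i.
have tsp_i := cycle_tsp_arc (proj2 (andP arc_im0)).
apply: leq_trans (leq_add tsp_i (leq_mul (leqnn 2) count)) _.
by have := ltn_ord m0; rewrite /n; lia.
Qed.

Lemma cycle_sum_tsp k : 0 < k ->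
  \sum_(S : {set 'I_n} | #|S| == k) tsp (cycle_rel n) S + 2 * (n * 'C(d.+1, k))
  <= n.+1 * 'C(n, k).
Proof.
move=> k_gt0.
(* The term for [m] is ['C(m + 1, k) - 'C(m, k)], so the sum telescopes. *)
have count i : \sum_(m < d.+1) \sum_(S : {set 'I_n} | #|S| == k) short_arc S i m
               = 'C(d.+1, k).
  have : d.+1 <= n by rewrite /n; lia.
  elim: d.+1 => [|p IHp] lt_pn; first by rewrite big_ord0 bin_small.
  have := sum_draws_through k (arc_start i p); rewrite (card_arc i lt_pn) => <-.
  by rewrite big_ord_recr IHp 1?ltnW //= addnC.
have -> : n * 'C(d.+1, k) =
    \sum_(S : {set 'I_n} | #|S| == k) \sum_i \sum_(m < d.+1) short_arc S i m.
  rewrite exchange_big /= -[n in LHS]card_ord -sum_nat_const.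
  by apply: eq_bigr => i _; rewrite exchange_big count.
rewrite big_distrr -big_split /= -[n in 'C(n, k)]card_ord -card_draws mulnC -sum_nat_const.
rewrite (eq_bigl (fun S => S \in [set A : {set 'I_n} | #|A| == k])); last by move=> S; rewrite inE.
apply: leq_sum => S; rewrite inE => /eqP cS.
by rewrite cycle_tsp_short_arc ?cS.
Qed.

End OddCycle.

(** * Trees given by a parent function *)

Lemma dist_le (T : finType) (e : rel T) x t : path e x t ->
  dist e x (last x t) <= size t.
Proof. by move=> pt; apply/least_nat_le/has_walkP; exists t. Qed.

Lemma dist_ge (T : finType) (e : rel T) (f : T -> nat) x y : connected_graph e ->
  (forall u v, e u v -> f v <= (f u).+1) -> f y <= f x + dist e x y.
Proof.
move=> e_conn f_lip.
have /least_natP/has_walkP : exists l, has_walk e x y l.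
  by have /connectP[t pt lt] := e_conn x y; exists (size t); apply/has_walkP; exists t.
rewrite -/(dist e x y) => -[t [pt <- <-]].
elim: t x pt => [|z t IHt] x /=; first by rewrite addn0.
by case/andP=> /f_lip exz /IHt pt; lia.
Qed.

(** The guards make 0 the root; a truncated [p 0 = 0] would otherwise create a loop there. *)
Definition parent_rel (n : nat) (p : nat -> nat) : rel 'I_n :=
  fun x y => (0 < x) && (p x == y) || (0 < y) && (p y == x).

Section ParentTree.
Variables (n : nat) (p : nat -> nat).
Hypothesis p_lt : forall i, 0 < i -> p i < i.
Let e := @parent_rel n p.

Lemma parent_rel_sym : symmetric e.
Proof. by move=> x y; rewrite /e /parent_rel orbC. Qed.

Lemma parent_relP (x y : 'I_n) : e x y -> p x = y /\ y < x \/ p y = x /\ x < y.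
Proof.
by case/orP=> /andP[pos /eqP pE]; [left | right]; split; rewrite // -pE p_lt.
Qed.

(** Both neighbours of the largest vertex of a cycle are smaller, hence both equal its parent,
    against [uniq]. *)
Lemma parent_rel_acyclic : acyclic_graph e.
Proof.
move=> [|x0 c0] // c_uniq c_size; apply/negP => c_cyc; set c := x0 :: c0 in c_uniq c_size c_cyc.
have c_x0 : x0 \in c by rewrite inE eqxx.
case: (arg_maxnP (fun x : 'I_n => x : nat) c_x0) => m c_m m_max.
have [i s def_s] := rot_to c_m.
move: c_cyc c_uniq c_size; rewrite -(rot_cycle i) -(rot_uniq i) -(size_rot i) def_s.
have nbr y : y \in m :: s -> e m y -> p m = y.
  rewrite -def_s mem_rot => /m_max /= le_ym /parent_relP[[]|[_]] //.
  by rewrite ltnNge le_ym.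
case: s def_s nbr => [|y s] //; case/lastP: s => [|s z] // def_s nbr.
rewrite [cycle _ _]/= rcons_path last_rcons => /and3P[e_my _ e_zm].
rewrite parent_rel_sym in e_zm.
have y_in : y \in m :: y :: rcons s z by rewrite !inE eqxx orbT.
have z_in : z \in m :: y :: rcons s z by rewrite !inE mem_rcons inE eqxx !orbT.
have eq_yz : y = z by apply: val_inj; rewrite /= -(nbr y) // -(nbr z).
by rewrite eq_yz /= mem_rcons inE eqxx andbF.
Qed.

Variable depth : nat -> nat.
Hypothesis depth0 : depth 0 = 0.
Hypothesis depthS : forall i, 0 < i -> depth i = (depth (p i)).+1.

Lemma walk_to_root (x : 'I_n) :
  exists t, [/\ path e x t, val (last x t) = 0 & size t = depth x].
Proof.
have [m le_xm] := ubnP (x : nat); elim: m x le_xm => // m IHm x le_xm.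
case: (posnP x) => [x0 | x_gt0]; first by exists [::]; rewrite /= x0 depth0.
have lt_px := p_lt x_gt0.
have lt_pn : p x < n := ltn_trans lt_px (ltn_ord x).
have [t [pt lt st]] := IHm (Ordinal lt_pn) (leq_trans lt_px le_xm).
exists (Ordinal lt_pn :: t); rewrite /= pt lt st (depthS x_gt0); split=> //.
by rewrite /e /parent_rel x_gt0 eqxx.
Qed.

Lemma parent_walk (x y : 'I_n) :
  exists t, [/\ path e x t, last x t = y & size t = depth x + depth y].
Proof.
have [t [pt lt st]] := walk_to_root x; have [u [pu lu su]] := walk_to_root y.
have eq_root : last x t = last y u by apply: val_inj; rewrite lt lu.
exists (t ++ rev (belast y u)); rewrite cat_path pt last_cat size_cat size_rev.
by rewrite size_belast st su eq_root last_rev_belast (rev_walk parent_rel_sym).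
Qed.

Lemma parent_rel_connected : connected_graph e.
Proof. by move=> x y; have [t [pt <- _]] := parent_walk x y; apply/connectP; exists t. Qed.

Lemma parent_rel_tree : is_tree e.
Proof.
split; last by split; [exact: parent_rel_connected | exact: parent_rel_acyclic].
split; first exact: parent_rel_sym.
by move=> x; apply/negP => /parent_relP; rewrite ltnn => -[[]|[]].
Qed.

Lemma parent_dist_le (x y : 'I_n) : dist e x y <= depth x + depth y.
Proof. by have [t [pt <- <-]] := parent_walk x y; exact: dist_le. Qed.

End ParentTree.

(** * The three-legged tree and its diameter *)

Section Spider.
Variable d : nat.
Hypothesis d_ge6 : 6 <= d.
Let n := 2 * d + 1.
Let leg_end := 3 * d./2 + odd d.

(* Vertices are dealt out to the three legs in turn, so that the leg of a vertex is its residue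
   modulo 3.  Vertices beyond [leg_end] are leaves at depth [d./2], hung on the last vertex but
   one of their leg; for odd [d] one leg is one edge longer, to make the diameter exactly [d]. *)
Definition spider_parent (i : nat) : nat :=
  if i <= leg_end then i - 3 else 3 * d./2 - 5 + (i + 2) %% 3.

Definition spider_depth (i : nat) : nat := if i <= leg_end then (i + 2) %/ 3 else d./2.

Definition spider : rel 'I_n := @parent_rel n spider_parent.

Lemma spider_parent_lt i : 0 < i -> spider_parent i < i.
Proof. by rewrite /spider_parent /leg_end; case: ifP => /=; lia. Qed.

Lemma spider_depthS i : 0 < i -> spider_depth i = (spider_depth (spider_parent i)).+1.
Proof.
by rewrite /spider_parent /spider_depth /leg_end; case: ifP => /= *; case: ifP => /=; lia.
Qed.

Lemma spider_depth0 : spider_depth 0 = 0. Proof. by []. Qed.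

Lemma spider_tree : is_tree spider.
Proof. exact: (parent_rel_tree _ spider_parent_lt spider_depth0 spider_depthS). Qed.

Lemma spider_parent_mod3 i : 0 < i -> 0 < spider_parent i ->
  spider_parent i = i %[mod 3].
Proof. by rewrite /spider_parent /leg_end; case: ifP => /=; lia. Qed.

Lemma diameter_spider : diameter spider = d.
Proof.
apply/eqP; rewrite eqn_leq; apply/andP; split.
  apply/bigmax_leqP => x _; apply/bigmax_leqP => y _.
  case: (eqVneq x y) => [-> | ne_xy].
    by have := @dist_le _ spider y [::] isT; rewrite leqn0 => /eqP /= ->.
  apply: leq_trans (parent_dist_le spider_parent_lt spider_depth0 spider_depthS x y) _.
  (* Only [leg_end], and only for odd [d], lies deeper than [d./2], so the depths of distinct
     vertices add up to at most [d]. *)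
  have {}ne_xy : x <> y :> nat by move/val_inj => eq_xy; rewrite eq_xy eqxx in ne_xy.
  by move: ne_xy; rewrite /spider_depth /leg_end; do 2 case: ifP => /=; lia.
have lt_xn : leg_end < n by rewrite /leg_end /n; lia.
have lt_yn : 3 * d./2 - 1 < n by rewrite /n; lia.
pose x := Ordinal lt_xn; pose y := Ordinal lt_yn.
(* A signed depth, negative on the leg of [y] and shifted by [d] to stay in [nat]. It changes by one
   along each edge and differs by [d] between [y] and [x]. *)
pose height v := if v %% 3 == 2 then d - spider_depth v else d + spider_depth v.
have conn : connected_graph spider by have [_ []] := spider_tree.
have height_parent i : 0 < i ->
    height i <= (height (spider_parent i)).+1 /\ height (spider_parent i) <= (height i).+1.
  move=> i_gt0; have := spider_depthS i_gt0; have := spider_parent_mod3 i_gt0.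
  rewrite /height; case: (posnP (spider_parent i)) => [-> _ | _ /(_ isT)].
    by rewrite spider_depth0 => ->; case: ifP => _ /=; lia.
  by move=> -> ->; case: ifP => _; lia.
have := @dist_ge _ spider (fun v : 'I_n => height v) y x conn.
have dist_yx := leq_trans (leq_bigmax (F := fun v => dist spider y v) x)
                          (leq_bigmax (F := fun u => \max_v dist spider u v) y).
move=> ge_yx; apply: leq_trans dist_yx; rewrite -(leq_add2l (height y)).
apply: leq_trans (ge_yx _).
  by rewrite /height /spider_depth /= /leg_end; do 4 case: ifP => /=; lia.
move=> u v /(parent_relP spider_parent_lt) [[<- lt]|[<- lt]].
  by apply: (height_parent u _).2; apply: leq_ltn_trans lt.
by apply: (height_parent v _).1; apply: leq_ltn_trans lt.
Qed.

(* The descendants of [v], provided [0 < v <= 3 * d./2 - 3]. *)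
Definition branch (v : nat) : pred 'I_n := fun w => (v <= w) && (w == v %[mod 3]).

(** The only edge leaving the branch is the one above [v]. The bound [3 * d./2 - 3] is the largest
    label carrying hung leaves, so the leaves of a leg lie beyond each of its admissible [v]. *)
Lemma branch_parent v i : 0 < v -> v <= 3 * d./2 - 3 -> 0 < i ->
  (v <= i) && (i == v %[mod 3]) !=
  (v <= spider_parent i) && (spider_parent i == v %[mod 3]) -> v = i.
Proof. by rewrite /spider_parent /leg_end; case: ifP => /=; lia. Qed.

Lemma card_branch v a : n <= v + 3 * a < n + 3 -> #|branch v| = a.
Proof.
move=> va; have n_gt0 : 0 < n by rewrite /n; lia.
pose f (i : 'I_a) : 'I_n := insubd (Ordinal n_gt0) (v + 3 * i).
have fE i : f i = v + 3 * i :> nat by rewrite val_insubd; have := ltn_ord i; case: ifP; lia.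
have f_inj : injective f.
  by move=> i j /(congr1 val); rewrite /= !fE => eq_ij; apply: val_inj => /=; lia.
rewrite -[RHS]card_ord -cardsT -(card_imset _ f_inj).
apply: eq_card => w; apply/idP/imsetP => [vw | [i _ ->]]; last first.
  by rewrite unfold_in fE; have := ltn_ord i; lia.
rewrite unfold_in in vw.
have lt_wa : (w - v) %/ 3 < a by have := ltn_ord w; lia.
by exists (Ordinal lt_wa) => //; apply: val_inj; rewrite /= fE /=; lia.
Qed.

End Spider.

(** * Comparison of the two sums *)

Section Comparison.
Import ZArith.

(** * Polynomial inequalities over the integers *)

Section Polynomials.
Local Open Scope Z_scope.

Definition Zffact4 x := x*(x-1)*(x-2)*(x-3).
Definition Zffact5 x := Zffact4 x*(x-4).
Definition Zffact6 x := Zffact5 x*(x-5).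
Definition Zffact7 x := Zffact6 x*(x-6).

(** On each class of [d] modulo 6 the roundings [B] of [2d/3] and [J] of [d/2 - 2] are linear in
    [t]. *)
Lemma split_mod6 d B J : 6000 <= d -> 3*B <= 2*d < 3*B+3 -> 2*J+4 <= d < 2*J+6 ->
  exists2 t, 0 <= t &
   [\/ d = 6*t+6000 /\ B = 4*t+4000 /\ J = 3*t+2998,
       d = 6*t+6001 /\ B = 4*t+4000 /\ J = 3*t+2998,
       d = 6*t+6002 /\ B = 4*t+4001 /\ J = 3*t+2999 |
       d = 6*t+6003 /\ B = 4*t+4002 /\ J = 3*t+2999 \/
       d = 6*t+6004 /\ B = 4*t+4002 /\ J = 3*t+3000 \/
       d = 6*t+6005 /\ B = 4*t+4003 /\ J = 3*t+3000].
Proof.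
move=> hd hB hJ; have := Z.mod_pos_bound (d - 6000) 6 erefl.
have := Z_div_mod_eq_full (d - 6000) 6.
move: (_ / _) (_ mod _) => t s ed s_bnd; exists t; first by lia.
have : s = 0 \/ s = 1 \/ s = 2 \/ s = 3 \/ s = 4 \/ s = 5 by lia.
case=> [?|[?|[?|[?|[?|?]]]]].
- by constructor 1; lia.
- by constructor 2; lia.
- by constructor 3; lia.
- by constructor 4; left; lia.
- by constructor 4; right; left; lia.
- by constructor 4; right; right; lia.
Qed.

Ltac poly_pos t t_ge0 :=
  apply/Z.lt_0_sub;
  have h2 := Z.pow_nonneg t 2 t_ge0; have h3 := Z.pow_nonneg t 3 t_ge0;
  have h4 := Z.pow_nonneg t 4 t_ge0; have h5 := Z.pow_nonneg t 5 t_ge0;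
  have h6 := Z.pow_nonneg t 6 t_ge0; have h7 := Z.pow_nonneg t 7 t_ge0;
  ring_simplify; lia.

(* The inequality of [cut_loss_lt] for [k = 4, 5, 6], multiplied by [(k+1)!] after summing
   [cut_loss] by [cut_lossE]; the threshold 6000 is chosen so that, after the substitution of
   [split_mod6], all coefficients of the difference are positive. *)
Lemma spider_beats_poly_4 d n B J : 6000 <= d ->
  3*B <= 2*d < 3*B+3 -> 2*J+4 <= d < 2*J+6 -> n = 2*d+1 ->
  5*(n+1)*Zffact4 n + 6 * (Zffact5 (B+1) - Zffact5 (B+1-J)
       + Zffact5 (n-B+J) - Zffact5 (n-B))
  < 30 * J * Zffact4 n + 10*n*Zffact4 (d+1).
Proof.
move=> hd hB hJ ->; rewrite /Zffact5 /Zffact4.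
have [t t_ge0] := split_mod6 hd hB hJ; clear hd hB hJ.
by case=> [|||[|[|]]] [-> [-> ->]]; poly_pos t t_ge0.
Qed.

Lemma spider_beats_poly_5 d n B J : 6000 <= d ->
  3*B <= 2*d < 3*B+3 -> 2*J+4 <= d < 2*J+6 -> n = 2*d+1 ->
  6*(n+1)*Zffact5 n + 6 * (Zffact6 (B+1) - Zffact6 (B+1-J)
       + Zffact6 (n-B+J) - Zffact6 (n-B))
  < 36 * J * Zffact5 n + 12*n*Zffact5 (d+1).
Proof.
move=> hd hB hJ ->; rewrite /Zffact6 /Zffact5 /Zffact4.
have [t t_ge0] := split_mod6 hd hB hJ; clear hd hB hJ.
by case=> [|||[|[|]]] [-> [-> ->]]; poly_pos t t_ge0.
Qed.

Lemma spider_beats_poly_6 d n B J : 6000 <= d ->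
  3*B <= 2*d < 3*B+3 -> 2*J+4 <= d < 2*J+6 -> n = 2*d+1 ->
  7*(n+1)*Zffact6 n + 6 * (Zffact7 (B+1) - Zffact7 (B+1-J)
       + Zffact7 (n-B+J) - Zffact7 (n-B))
  < 42 * J * Zffact6 n.
Proof.
move=> hd hB hJ ->; rewrite /Zffact7 /Zffact6 /Zffact5 /Zffact4.
have [t t_ge0] := split_mod6 hd hB hJ; clear hd hB hJ.
by case=> [|||[|[|]]] [-> [-> ->]]; poly_pos t t_ge0.
Qed.

End Polynomials.

(** Raising [k] by one multiplies ['C(x, k) / 'C(n, k)] by [(x - k) / (n - k)], which is at most 1.
    This carries the case [k = 6] to larger [k]. *)
Lemma bin_ratio_le x n j k : x <= n -> j <= k ->
  'C(x, k) * 'C(n, j) <= 'C(n, k) * 'C(x, j).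
Proof.
move=> le_xn; elim: k => [|k IHk]; first by rewrite leqn0 => /eqP ->; rewrite mulnC.
rewrite leq_eqVlt => /predU1P[-> | /IHk {}IHk]; first by rewrite mulnC.
rewrite -(leq_pmul2l (ltn0Sn k)) !mulnA !mul_bin_left -!mulnA.
by apply: leq_mul => //; apply: leq_sub2r.
Qed.

Lemma sum_bin_up c J k :
  \sum_(j < J) 'C(c + j, k) + 'C(c, k.+1) = 'C(c + J, k.+1).
Proof.
elim: J => [|J IHJ]; first by rewrite big_ord0 addn0.
by rewrite big_ord_recr addnAC IHJ addnS binS.
Qed.

Lemma sum_bin_down B J k : J <= B.+1 ->
  \sum_(j < J) 'C(B - j, k) + 'C(B.+1 - J, k.+1) = 'C(B.+1, k.+1).
Proof.
elim: J => [|J IHJ] lt_J; first by rewrite big_ord0 subn0.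
rewrite -(IHJ (ltnW lt_J)) big_ord_recr -addnA; congr (_ + _).
by rewrite (subSn (m := J)) // subSS binS addnC.
Qed.

(* The number of pairs (cut, [k]-set) with the set on one side of the cut, for one leg
   whose [J] cuts have [B], [B - 1], ... vertices beyond them. *)
Definition cut_loss (n B J k : nat) : nat :=
  \sum_(j < J) ('C(B - j, k) + 'C(n - (B - j), k)).

Lemma cut_lossE n B J k : J <= B.+1 -> B <= n ->
  cut_loss n B J k + 'C(B.+1 - J, k.+1) + 'C(n - B, k.+1)
  = 'C(B.+1, k.+1) + 'C(n - B + J, k.+1).
Proof.
move=> le_JB le_Bn; rewrite /cut_loss big_split /=.
rewrite -(sum_bin_down _ le_JB) -(sum_bin_up (n - B)).
suff -> : \sum_(j < J) 'C(n - (B - j), k) = \sum_(j < J) 'C(n - B + j, k).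
  by rewrite -addnA addnACA.
by apply: eq_bigr => j _; congr 'C(_, _); have := ltn_ord j; lia.
Qed.

(** Untruncated subtraction is harmless here: for [n < k] both binomials vanish. *)
Lemma bin_succZ n k :
  (Z.of_nat k.+1 * Z.of_nat 'C(n, k.+1) = Z.of_nat 'C(n, k) * (Z.of_nat n - Z.of_nat k))%Z.
Proof.
have := mul_bin_left n k.
case: (leqP k n) => [le_kn|lt_nk]; first by nia.
by rewrite !bin_small //; lia.
Qed.

Lemma bin_Zffact4 n : (24 * Z.of_nat 'C(n, 4) = Zffact4 (Z.of_nat n))%Z.
Proof.
have := bin_succZ n 0; have := bin_succZ n 1; have := bin_succZ n 2.
have := bin_succZ n 3; rewrite bin0 /Zffact4 => e3 e2 e1 e0.
have -> : (24 * Z.of_nat 'C(n, 4) = 6 * (Z.of_nat 4 * Z.of_nat 'C(n, 4)))%Z by lia.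
rewrite e3.
have -> x : (6 * (Z.of_nat 'C(n, 3) * x) = 2 * (Z.of_nat 3 * Z.of_nat 'C(n, 3)) * x)%Z by lia.
rewrite e2.
have -> x y : (2 * (Z.of_nat 'C(n, 2) * x) * y = (Z.of_nat 2 * Z.of_nat 'C(n, 2)) * x * y)%Z by lia.
by rewrite e1; lia.
Qed.

Lemma bin_Zffact5 n : (120 * Z.of_nat 'C(n, 5) = Zffact5 (Z.of_nat n))%Z.
Proof. by rewrite /Zffact5 -bin_Zffact4; have := bin_succZ n 4; lia. Qed.

Lemma bin_Zffact6 n : (720 * Z.of_nat 'C(n, 6) = Zffact6 (Z.of_nat n))%Z.
Proof. by rewrite /Zffact6 -bin_Zffact5; have := bin_succZ n 5; lia. Qed.

Lemma bin_Zffact7 n : (5040 * Z.of_nat 'C(n, 7) = Zffact7 (Z.of_nat n))%Z.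
Proof. by rewrite /Zffact7 -bin_Zffact6; have := bin_succZ n 6; lia. Qed.

Lemma cut_loss_lt k : 4 <= k -> exists D, forall d n B J,
  D <= d -> k <= d -> n = 2 * d + 1 -> B = 2 * d %/ 3 -> J = d./2 - 2 ->
  n.+1 * 'C(n, k) + 6 * cut_loss n B J k
  < 6 * (J * 'C(n, k)) + 2 * (n * 'C(d.+1, k)).
Proof.
(* The threshold of the polynomial inequalities, written in binary. *)
move=> k_ge4; exists (Z.to_nat 6000) => d n B J d_big le_kd n_def B_def J_def.
have dZ : (6000 <= Z.of_nat d)%Z by lia.
have BZ : (3 * Z.of_nat B <= 2 * Z.of_nat d < 3 * Z.of_nat B + 3)%Z by lia.
have JZ : (2 * Z.of_nat J + 4 <= Z.of_nat d < 2 * Z.of_nat J + 6)%Z by lia.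
have nE : (Z.of_nat n = 2 * Z.of_nat d + 1)%Z by lia.
have le_JB : J <= B.+1 by lia.
have le_Bn : B <= n by lia.
have lossE j := cut_lossE j le_JB le_Bn.
have argsZ : [/\ Z.of_nat B.+1 = Z.of_nat B + 1, Z.of_nat d.+1 = Z.of_nat d + 1,
  Z.of_nat (B.+1 - J) = Z.of_nat B + 1 - Z.of_nat J,
  Z.of_nat (n - B) = Z.of_nat n - Z.of_nat B &
  Z.of_nat (n - B + J) = Z.of_nat n - Z.of_nat B + Z.of_nat J]%Z by split; lia.
have {argsZ} [B1E d1E BJE nBE nBJE] := argsZ.
have [->|[->|k_ge6]] : k = 4 \/ k = 5 \/ 6 <= k by lia.
- have := spider_beats_poly_4 dZ BZ JZ nE.
  rewrite -BJE -B1E -d1E -nBJE -nBE -!bin_Zffact4 -!bin_Zffact5.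
  have := lossE 4; clear; nia.
- have := spider_beats_poly_5 dZ BZ JZ nE.
  rewrite -BJE -B1E -d1E -nBJE -nBE -!bin_Zffact5 -!bin_Zffact6.
  have := lossE 5; clear; nia.
(* For [k = 6] the inequality holds even without the term in ['C(d.+1, k)]. Scaling it by
   ['C(n, k) / 'C(n, 6)] gives all larger [k], since the loss shrinks relative to ['C(n, k)]. *)
have loss6 : n.+1 * 'C(n, 6) + 6 * cut_loss n B J 6 < 6 * (J * 'C(n, 6)).
  have := spider_beats_poly_6 dZ BZ JZ nE.
  rewrite -BJE -B1E -nBJE -nBE -!bin_Zffact6 -!bin_Zffact7.
  have := lossE 6; clear; nia.
have Cn_gt0 : 0 < 'C(n, k) by rewrite bin_gt0; lia.
have C6_gt0 : 0 < 'C(n, 6) by rewrite bin_gt0; lia.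
have ratio : cut_loss n B J k * 'C(n, 6) <= 'C(n, k) * cut_loss n B J 6.
  rewrite /cut_loss big_distrl big_distrr /=; apply: leq_sum => j _.
  rewrite mulnDl mulnDr; apply: leq_add; apply: bin_ratio_le => //; lia.
apply: ltn_addr; rewrite -(ltn_pmul2r C6_gt0).
have : 'C(n, k) * (n.+1 * 'C(n, 6) + 6 * cut_loss n B J 6) < 'C(n, k) * (6 * (J * 'C(n, 6))).
  by rewrite ltn_pmul2l.
clear -ratio; nia.
Qed.

End Comparison.

(** * Lower bound for the tree and conclusion *)

Lemma spider_sum_tsp d k n B J : 6 <= d -> 0 < k ->
  n = 2 * d + 1 -> B = 2 * d %/ 3 -> J = d./2 - 2 ->
  6 * (J * 'C(n, k))
  <= \sum_(S : {set 'I_(2 * d + 1)} | #|S| == k) tsp (spider (d := d)) S + 6 * cut_loss n B J k.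
Proof.
move=> d_ge6 k_gt0 -> B_def J_def.
have n_gt0 : 0 < 2 * d + 1 by lia.
(* For fixed [j] these are three consecutive labels, one per leg, each with exactly [B - j] vertices
   in its branch. The choice of [J] keeps them within the range of [branch_parent]. *)
pose root (j : 'I_J) (r : 'I_3) := 2 * d + 1 - 3 * (B - j) + r.
pose cut (i : 'I_J * 'I_3) := branch (d := d) (root i.1 i.2).
have root_bnd j r : 0 < root j r <= 3 * d./2 - 3.
  by have := ltn_ord j; have := ltn_ord r; rewrite /root; lia.
have root_inj i i' : root i.1 i.2 = root i'.1 i'.2 -> i = i'.
  case: i i' => [j r] [j' r'] /=.
  have := (ltn_ord j, ltn_ord r, ltn_ord j', ltn_ord r') => -[[[]]] lt_j lt_r lt_j' lt_r'.
  by rewrite /root => eq_root; congr (_, _); apply: val_inj => /=; lia.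
have edge_cut x y : spider x y -> \sum_i (cut i x != cut i y) <= 1.
  move=> exy.
  (* An edge can only be cut at its child endpoint [c], and distinct cuts have distinct roots. *)
  have [c cut_c] : exists c, forall i, cut i x != cut i y -> root i.1 i.2 = c.
    case/orP: exy => /andP[pos /eqP pE].
      exists (x : nat) => i; rewrite /cut /branch -pE; apply: branch_parent => //;
        by case/andP: (root_bnd i.1 i.2).
    exists (y : nat) => i; rewrite /cut /branch -pE eq_sym; apply: branch_parent => //;
      by case/andP: (root_bnd i.1 i.2).
  rewrite -big_mkcond /= sum1_card; apply/card_le1_eqP => i i' /cut_c ci /cut_c ci'.
  by apply: root_inj; rewrite ci ci'.
have [_ [conn _]] := spider_tree d_ge6.
have sum_le : \sum_(S : {set 'I_(2 * d + 1)} | #|S| == k) 2 * \sum_i separates (cut i) S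
   <= \sum_(S : {set 'I_(2 * d + 1)} | #|S| == k) tsp (spider (d := d)) S.
  by apply: leq_sum => S _; apply: (sum_separates_tsp edge_cut (Ordinal n_gt0) S conn).
apply: leq_trans (leq_add sum_le (leqnn _)).
rewrite -big_distrr exchange_big /=.
have sep_cut j r : \sum_(S : {set 'I_(2 * d + 1)} | #|S| == k) separates (cut (j, r)) S
    + ('C(B - j, k) + 'C(2 * d + 1 - (B - j), k)) = 'C(2 * d + 1, k).
  have := sum_separates (cut (j, r)) k_gt0; rewrite card_ord.
  rewrite (@card_branch _ _ _ (B - j)) // /root /=.
  by have := ltn_ord j; have := ltn_ord r; lia.
have sumC : \sum_(i : 'I_J * 'I_3)
    (\sum_(S : {set 'I_(2 * d + 1)} | #|S| == k) separates (cut i) S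
      + ('C(B - i.1, k) + 'C(2 * d + 1 - (B - i.1), k))) = J * 3 * 'C(2 * d + 1, k).
  rewrite (eq_bigr (fun=> 'C(2 * d + 1, k))); last by case=> j r _; apply: sep_cut.
  by rewrite sum_nat_const card_prod !card_ord.
have sumL : \sum_(i : 'I_J * 'I_3) ('C(B - i.1, k) + 'C(2 * d + 1 - (B - i.1), k))
    = 3 * cut_loss (2 * d + 1) B J k.
  pose loss (j : 'I_J) (_ : 'I_3) := 'C(B - j, k) + 'C(2 * d + 1 - (B - j), k).
  rewrite -(pair_bigA _ loss) /loss /=.
  rewrite /cut_loss big_distrr; apply: eq_bigr => j _.
  by rewrite sum_nat_const card_ord.
move: sumC; rewrite big_split /= sumL; lia.
Qed.

Theorem theorem6 (k : nat) : 4 <= k ->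
  exists D : nat, forall d : nat, D <= d ->
    exists e : rel 'I_(2 * d + 1),
      is_tree e /\ diameter e = d /\
      (mu_tsp (cycle_rel (2 * d + 1)%N) k < mu_tsp e k)%R.
Proof.
move=> k_ge4; have [D D_spec] := cut_loss_lt k_ge4.
exists (D + k + 6) => d d_big.
have [d_ge6 k_gt0] : 6 <= d /\ 0 < k by lia.
exists (spider (d := d)); split; first exact: spider_tree.
split; first exact: diameter_spider.
rewrite /mu_tsp card_ord ltr_pM2r ?invr_gt0 ?ltr0n ?bin_gt0 1?ltr_nat; last by lia.
have D_le_d : D <= d by lia.
have k_le_d : k <= d by lia.
have combine (a b c x y z : nat) : a + c <= x -> y <= b + z -> x + z < y + c -> a < b by lia.
exact: combine (cycle_sum_tsp d k_gt0) (spider_sum_tsp d_ge6 k_gt0 erefl erefl erefl)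
  (D_spec _ _ _ _ D_le_d k_le_d erefl erefl erefl).
Qed.
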